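(* Consider the algorithm RSDFO (described in the context) applied to $f:\mathbb{R}^n\to\mathbb{R}$. Suppose that: (i) $f$ is bounded below by $f_{\rm low}$ and continuously differentiable, and $\nabla f$ is $L_{\nabla f}$-Lipschitz continuous on $\{y\in\mathbb{R}^n : \|y-x\|\le\Delta_{\max}\text{ for some } x \text{ with } f(x)\le f(x_0)\}$ for some $L_{\nabla f}>0$; (ii) $\|\hat H_k\|\le\kappa_H$ for all $k$, for some $\kappa_H\ge 1$; (iii) the trust-region subproblem solver always gives a step $\hat s_k$ with $\hat m_k(0)-\hat m_k(\hat s_k)\ge c_1\|\hat g_k\|\min\left(\Delta_k,\frac{\|\hat g_k\|}{\max(\|\hat H_k\|,1)}\right)$, for some $c_1\in[1/2,1]$ independent of $k$; (iv) at each iteration $k$ in which CHECK_MODEL = FALSE, $Q_k$ is well-aligned for some fixed $\alpha_Q\in(0,1)$ with probability at least $1-\delta_S$, for some $\delta_S\in(0,1)$, independently of $\{Q_0,\ldots,Q_{k-1}\}$; and $\|Q_k\|\le Q_{\max}$ for all $k$ and some $Q_{\max}>0$; (v) $\beta_F\le c_2:=2c_1/(1+\sqrt{1+2c_1})$, $\gamma_{\rm inc}>\min(\gamma_C,\gamma_F,\gamma_{\rm dec},\beta_F)^{-2}$, and $\delta_S<1/(1+C_4)$ (with $C_4$ as defined in the context). Let $K_\epsilon:=\min\{k:\|\nabla f(x_k)\|\le\epsilon\}$. Let $k_0$ and $c,C>0$ be constants such that $\mathbb{P}[\min_{j\le k}\|\nabla f(x_j)\|\le C/\sqrt k]\ge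 1-e^{-ck}$ for all $k\ge k_0$, and let $\epsilon_0,\widetilde c,\widetilde C>0$ be constants such that $\mathbb{P}[K_\epsilon\le\widetilde C\epsilon^{-2}]\ge1-e^{-\widetilde c\,\epsilon^{-2}}$ for all $\epsilon\in(0,\epsilon_0)$ (such constants exist whenever (i)–(v) hold). Then for all $k\ge k_0$, $$\mathbb{E}\left[\min_{j\le k}\|\nabla f(x_j)\|\right]\le Ck^{-1/2}+\|\nabla f(x_0)\|e^{-ck},$$ and for all $\epsilon\in(0,\epsilon_0)$, $$\mathbb{E}[K_\epsilon]\le\widetilde C_1\epsilon^{-2}+\frac1{\widetilde c_1},$$ for some constants $\widetilde c_1,\widetilde C_1>0$.
   Context: $\|\cdot\|$ is the Euclidean norm of vectors and operator 2-norm of matrices; $B(x,\Delta)$ is the closed Euclidean ball. Full linearity: given $Q\in\mathbb{R}^{n\times p}$, a model $\hat m:\mathbb{R}^p\to\mathbb{R}$ is $Q$-fully linear in $B(x,\Delta)\subset\mathbb{R}^n$ if for all $\hat s\in\mathbb{R}^p$ with $\|\hat s\|\le\Delta$: $|f(x+Q\hat s)-\hat m(\hat s)|\le\kappa_{\rm ef}\Delta^2$ and $\|Q^T\nabla f(x+Q\hat s)-\nabla\hat m(\hat s)\|\le\kappa_{\rm eg}\Delta$, where $\kappa_{\rm ef},\kappa_{\rm eg}$ are constants independent of $Q,\hat m,x,\Delta$. Algorithm RSDFO. Inputs: $x_0\in\mathbb{R}^n$, $\Delta_0>0$, $p\in\{1,\ldots,n\}$. Parameters: $\Delta_{\max}\ge\Delta_0$;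 $0<\gamma_{\rm dec}<1<\gamma_{\rm inc}\le\overline\gamma_{\rm inc}$; $\epsilon_C,\mu>0$; $0<\gamma_C<1$; $\beta_F>0$; $0<\gamma_F<1$; $0<\eta_1\le\eta_2<1$. Initially CHECK_MODEL = FALSE. It is assumed that procedures are available to verify $Q_k$-full linearity and to generate $Q_k$-fully linear models. For $k=0,1,2,\ldots$: 1. If CHECK_MODEL = TRUE, set $Q_k=Q_{k-1}$ and construct a model $\hat m_k(\hat s)=f(x_k)+\hat g_k^T\hat s+\frac12\hat s^T\hat H_k\hat s$ on $\mathbb{R}^p$ ($\hat H_k$ symmetric) which is $Q_k$-fully linear in $B(x_k,\Delta_k)$. Otherwise, randomly sample $Q_k\in\mathbb{R}^{n\times p}$ and construct a model $\hat m_k$ of the same form which need not be $Q_k$-fully linear. 2. (Criticality step) If $\|\hat g_k\|<\epsilon_C$ and ($\|\hat g_k\|<\mu^{-1}\Delta_k$ or $\hat m_k$ is not $Q_k$-fully linear in $B(x_k,\Delta_k)$), set $x_{k+1}=x_k$, $\Delta_{k+1}=\gamma_C\Delta_k$, CHECK_MODEL = TRUE, and go to the next iteration. 3. Otherwise, approximately solve $\min_{\hat s\in\mathbb{R}^p}\hat m_k(\hat s)$ s.t. $\|\hat s\|\le\Delta_k$ to get $\hat s_k$, and set $s_k=Q_k\hat s_k$. (a) (Safety step) If $\|\hat s_k\|<\beta_F\Delta_k$, set $x_{k+1}=x_k$, $\Delta_{k+1}=\gamma_F\Delta_k$; set CHECK_MODEL = FALSE if $\hat m_k$ is $Q_k$-fully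 linear in $B(x_k,\Delta_k)$, and TRUE otherwise. (b) Otherwise compute $\rho_k=\frac{f(x_k)-f(x_k+s_k)}{\hat m_k(0)-\hat m_k(\hat s_k)}$; set $x_{k+1}=x_k+s_k$ if $\rho_k\ge\eta_1$ and $x_{k+1}=x_k$ otherwise; set $\Delta_{k+1}=\min(\max(\gamma_{\rm inc}\Delta_k,\overline\gamma_{\rm inc}\|\hat s_k\|),\Delta_{\max})$ if $\rho_k\ge\eta_2$, $\Delta_{k+1}=\max(\gamma_{\rm dec}\Delta_k,\|\hat s_k\|)$ if $\eta_1\le\rho_k<\eta_2$, and $\Delta_{k+1}=\min(\gamma_{\rm dec}\Delta_k,\|\hat s_k\|)$ if $\rho_k<\eta_1$. If $\rho_k\ge\eta_2$ or $\hat m_k$ is $Q_k$-fully linear in $B(x_k,\Delta_k)$, set CHECK_MODEL = FALSE; otherwise set it to TRUE. $Q_k$ is well-aligned if $\|Q_k^T\nabla f(x_k)\|\ge\alpha_Q\|\nabla f(x_k)\|$, for a fixed $\alpha_Q\in(0,1)$ independent of $k$. Constants: $C_1=\frac{\log\overline\gamma_{\rm inc}}{\log(1/\max(\gamma_C,\gamma_F,\gamma_{\rm dec}))}$, $C_3=\frac{\log(1/\min(\gamma_C,\gamma_F,\gamma_{\rm dec},\beta_F))}{\log\gamma_{\rm inc}}$, $C_4=\max\left(C_1,\frac{4C_3}{1-2C_3}\right)$. *)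

(* Defs.v *)
From mathcomp Require Import all_boot all_order all_algebra.
From mathcomp Require Import all_classical all_reals all_analysis.
Set Implicit Arguments.
Unset Strict Implicit.
Unset Printing Implicit Defensive.
Import Order.TTheory GRing.Theory Num.Theory.
Import numFieldNormedType.Exports.
Local Open Scope classical_set_scope.
Local Open Scope ring_scope.

(* The library norm [`|_|] on matrices is the max norm, so the Euclidean norm
   and the operator 2-norm are defined here. *)
Definition enorm (R : realType) (n : nat) (v : 'cV[R]_n) : R :=
  Num.sqrt (\sum_(i < n) v i 0 ^+ 2).

Definition opnorm (R : realType) (m n : nat) (A : 'M[R]_(m, n)) : R :=
  sup [set enorm (A *m v) | v in [set v : 'cV[R]_n | enorm v <= 1]].

Definition dotv (R : realType) (n : nat) (u v : 'cV[R]_n) : R :=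
  \sum_(i < n) u i 0 * v i 0.

Definition grad (R : realType) (n : nat) (f : 'cV[R]_n -> R) (x : 'cV[R]_n) :
  'cV[R]_n := \col_i 'D_(delta_mx i 0) f x.

Definition continuously_differentiable (R : realType) (n : nat)
    (f : 'cV[R]_n -> R) : Prop :=
  (forall x, differentiable f x) /\ continuous (grad f).

Definition grad_lipschitz_on (R : realType) (n : nat) (f : 'cV[R]_n -> R)
    (L : R) (D : set 'cV[R]_n) : Prop :=
  forall y z, D y -> D z -> enorm (grad f y - grad f z) <= L * enorm (y - z).

Definition fully_linear (R : realType) (n p : nat) (kef keg : R)
    (f : 'cV[R]_n -> R) (Q : 'M[R]_(n, p)) (mhat : 'cV[R]_p -> R)
    (x : 'cV[R]_n) (Delta : R) : Prop :=
  forall s : 'cV[R]_p, enorm s <= Delta ->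
    `|f (x + Q *m s) - mhat s| <= kef * Delta ^+ 2 /\
    enorm (Q^T *m grad f (x + Q *m s) - grad mhat s) <= keg * Delta.

Definition well_aligned (R : realType) (n p : nat) (alphaQ : R)
    (f : 'cV[R]_n -> R) (Q : 'M[R]_(n, p)) (x : 'cV[R]_n) : Prop :=
  alphaQ * enorm (grad f x) <= enorm (Q^T *m grad f x).

Record rsdfo_params (R : realType) := RSDFOParams {
  Delta0 : R;
  Delta_max : R;
  gamma_dec : R;
  gamma_inc : R;
  gamma_inc_bar : R;
  eps_C : R;
  mu : R;
  gamma_C : R;
  beta_F : R;
  gamma_F : R;
  eta1 : R;
  eta2 : R }.

Record valid_params (R : realType) (prm : rsdfo_params R) : Prop := ValidParams {
  Delta0_gt0 : 0 < Delta0 prm;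
  Delta0_le_max : Delta0 prm <= Delta_max prm;
  gamma_dec_gt0 : 0 < gamma_dec prm;
  gamma_dec_lt1 : gamma_dec prm < 1;
  gamma_inc_gt1 : 1 < gamma_inc prm;
  gamma_inc_le_bar : gamma_inc prm <= gamma_inc_bar prm;
  eps_C_gt0 : 0 < eps_C prm;
  mu_gt0 : 0 < mu prm;
  gamma_C_gt0 : 0 < gamma_C prm;
  gamma_C_lt1 : gamma_C prm < 1;
  beta_F_gt0 : 0 < beta_F prm;
  gamma_F_gt0 : 0 < gamma_F prm;
  gamma_F_lt1 : gamma_F prm < 1;
  eta1_gt0 : 0 < eta1 prm;
  eta1_le_eta2 : eta1 prm <= eta2 prm;
  eta2_lt1 : eta2 prm < 1 }.

(* The quantities produced by one execution. [check_model k] is the value of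
   the flag on entering iteration k. The step [sh k] is only meaningful when
   iteration k gets past the criticality step, and is unconstrained
   otherwise. *)
Record trajectory (R : realType) (n p : nat) := Trajectory {
  xk : nat -> 'cV[R]_n;
  Delta : nat -> R;
  check_model : nat -> bool;
  Qk : nat -> 'M[R]_(n, p);
  gh : nat -> 'cV[R]_p;
  Hh : nat -> 'M[R]_p;
  sh : nat -> 'cV[R]_p }.

Definition model (R : realType) (n p : nat) (f : 'cV[R]_n -> R)
    (tr : trajectory R n p) (k : nat) (s : 'cV[R]_p) : R :=
  f (xk tr k) + dotv (gh tr k) s + 2^-1 * dotv s (Hh tr k *m s).

Definition model_fl (R : realType) (n p : nat) (kef keg : R)
    (f : 'cV[R]_n -> R) (tr : trajectory R n p) (k : nat) : Prop :=
  fully_linear kef keg f (Qk tr k) (model f tr k) (xk tr k) (Delta tr k).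

Definition criticality (R : realType) (n p : nat) (prm : rsdfo_params R)
    (kef keg : R) (f : 'cV[R]_n -> R) (tr : trajectory R n p) (k : nat) : Prop :=
  enorm (gh tr k) < eps_C prm /\
  (enorm (gh tr k) < (mu prm)^-1 * Delta tr k \/ ~ model_fl kef keg f tr k).

Definition rho (R : realType) (n p : nat) (f : 'cV[R]_n -> R)
    (tr : trajectory R n p) (k : nat) : R :=
  (f (xk tr k) - f (xk tr k + Qk tr k *m sh tr k)) /
  (model f tr k 0 - model f tr k (sh tr k)).

Definition criticality_update (R : realType) (n p : nat)
    (prm : rsdfo_params R) (tr : trajectory R n p) (k : nat) : Prop :=
  [/\ xk tr k.+1 = xk tr k,
      Delta tr k.+1 = gamma_C prm * Delta tr k &
      check_model tr k.+1 = true].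

Definition safety_update (R : realType) (n p : nat) (prm : rsdfo_params R)
    (kef keg : R) (f : 'cV[R]_n -> R) (tr : trajectory R n p) (k : nat) : Prop :=
  [/\ xk tr k.+1 = xk tr k,
      Delta tr k.+1 = gamma_F prm * Delta tr k &
      check_model tr k.+1 = ~~ `[< model_fl kef keg f tr k >]].

Definition main_update (R : realType) (n p : nat) (prm : rsdfo_params R)
    (kef keg : R) (f : 'cV[R]_n -> R) (tr : trajectory R n p) (k : nat) : Prop :=
  let r := rho f tr k in
  let s := sh tr k in
  [/\ xk tr k.+1 =
        (if eta1 prm <= r then xk tr k + Qk tr k *m s else xk tr k),
      Delta tr k.+1 =
        (if eta2 prm <= r then
           Num.min (Num.max (gamma_inc prm * Delta tr k)
                            (gamma_inc_bar prm * enorm s)) (Delta_max prm)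
         else if eta1 prm <= r then
           Num.max (gamma_dec prm * Delta tr k) (enorm s)
         else Num.min (gamma_dec prm * Delta tr k) (enorm s)) &
      check_model tr k.+1 =
        ~~ ((eta2 prm <= r) || `[< model_fl kef keg f tr k >])].

Definition rsdfo_iteration (R : realType) (n p : nat) (prm : rsdfo_params R)
    (kef keg : R) (f : 'cV[R]_n -> R) (tr : trajectory R n p) (k : nat) : Prop :=
  [/\ (check_model tr k -> Qk tr k = Qk tr k.-1 /\ model_fl kef keg f tr k),
      (Hh tr k)^T = Hh tr k,
      (criticality prm kef keg f tr k -> criticality_update prm tr k) &
      (~ criticality prm kef keg f tr k ->
         [/\ enorm (sh tr k) <= Delta tr k,
             (enorm (sh tr k) < beta_F prm * Delta tr k ->
                safety_update prm kef keg f tr k) &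
             (beta_F prm * Delta tr k <= enorm (sh tr k) ->
                main_update prm kef keg f tr k)])].

Definition rsdfo_execution (R : realType) (n p : nat) (prm : rsdfo_params R)
    (kef keg : R) (f : 'cV[R]_n -> R) (x0 : 'cV[R]_n)
    (tr : trajectory R n p) : Prop :=
  [/\ xk tr 0 = x0, Delta tr 0 = Delta0 prm, check_model tr 0 = false &
      forall k, rsdfo_iteration prm kef keg f tr k].

Definition solver_decrease (R : realType) (n p : nat) (prm : rsdfo_params R)
    (kef keg c1 : R) (f : 'cV[R]_n -> R) (tr : trajectory R n p) : Prop :=
  forall k, ~ criticality prm kef keg f tr k ->
    c1 * enorm (gh tr k) *
      Num.min (Delta tr k) (enorm (gh tr k) / Num.max (opnorm (Hh tr k)) 1)
    <= model f tr k 0 - model f tr k (sh tr k).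

Definition borel_measurable (d : measure_display) (T : measurableType d)
    (R : realType) (m n : nat) (X : T -> 'M[R]_(m, n)) : Prop :=
  measurable_fun [set: T]
    (X : T -> g_sigma_algebraType (@open 'M[R]_(m, n))).

Record random_trajectory (d : measure_display) (T : measurableType d)
    (R : realType) (n p : nat) (S : T -> trajectory R n p) : Prop :=
  RandomTrajectory {
  xk_measurable : forall k, borel_measurable (fun w => xk (S w) k);
  Delta_measurable : forall k,
    measurable_fun [set: T] (fun w => Delta (S w) k);
  check_model_measurable : forall k,
    measurable_fun [set: T] (fun w => check_model (S w) k);
  Qk_measurable : forall k, borel_measurable (fun w => Qk (S w) k);
  gh_measurable : forall k, borel_measurable (fun w => gh (S w) k);
  Hh_measurable : forall k, borel_measurable (fun w => Hh (S w) k);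
  sh_measurable : forall k, borel_measurable (fun w => sh (S w) k) }.

(* The sigma-algebra generated by Q_0, ..., Q_{k-1}. *)
Definition sigma_Q (T : Type) (R : realType) (n p : nat)
    (S : T -> trajectory R n p) (k : nat) : set (set T) :=
  <<s [set A | exists (j : nat) (U : set 'M[R]_(n, p)),
         [/\ (j < k)%N, open U & A = (fun w => Qk (S w) j) @^-1` U]] >>.

(* On {CHECK_MODEL = FALSE at k}, the conditional probability given
   Q_0, ..., Q_{k-1} that Q_k is well-aligned is at least 1 - deltaS; written
   without conditional expectation, by integrating over every event E of the
   past. *)
Definition well_aligned_whp (d : measure_display) (T : measurableType d)
    (R : realType) (P : probability T R) (n p : nat) (f : 'cV[R]_n -> R)
    (alphaQ deltaS : R) (S : T -> trajectory R n p) : Prop :=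
  forall (k : nat) (E : set T), sigma_Q S k E ->
    let F := [set w | check_model (S w) k = false] in
    let A := [set w | well_aligned alphaQ f (Qk (S w) k) (xk (S w) k)] in
    ((1 - deltaS)%:E * P (E `&` F) <= P (E `&` F `&` A))%E.

Definition C1 (R : realType) (prm : rsdfo_params R) : R :=
  ln (gamma_inc_bar prm) /
  ln (Num.max (Num.max (gamma_C prm) (gamma_F prm)) (gamma_dec prm))^-1.

Definition gamma_min (R : realType) (prm : rsdfo_params R) : R :=
  Num.min (Num.min (Num.min (gamma_C prm) (gamma_F prm)) (gamma_dec prm))
          (beta_F prm).

Definition C3 (R : realType) (prm : rsdfo_params R) : R :=
  ln (gamma_min prm)^-1 / ln (gamma_inc prm).

Definition C4 (R : realType) (prm : rsdfo_params R) : R :=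
  Num.max (C1 prm) (4 * C3 prm / (1 - 2 * C3 prm)).

Definition min_grad (R : realType) (n p : nat) (f : 'cV[R]_n -> R)
    (tr : trajectory R n p) (k : nat) : R :=
  \big[Order.min/enorm (grad f (xk tr 0))]_(j < k.+1) enorm (grad f (xk tr j)).

(* +oo when the tolerance is never reached. *)
Definition K_eps (R : realType) (n p : nat) (f : 'cV[R]_n -> R)
    (tr : trajectory R n p) (eps : R) : \bar R :=
  ereal_inf [set (k%:R)%:E | k in
    [set k : nat | enorm (grad f (xk tr k)) <= eps]].

(* Main.v *)
Require Import Defs.
From mathcomp Require Import all_boot all_order all_algebra.
From mathcomp Require Import all_classical all_reals all_analysis.
From mathcomp Require Import measurable_realfun zify.
Import Order.TTheory GRing.Theory Num.Theory.
Import numFieldNormedType.Exports.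
Local Open Scope classical_set_scope.
Local Open Scope ring_scope.

(** Both conclusions turn a bound that holds with high probability into a bound
    on an expectation, for the sequence of random variables given by the
    gradient norms along the trajectory.

    The smallest gradient norm is at most the first one, which is the
    deterministic number b := ||grad f(x0)||. So it is bounded by C / sqrt k on
    an event whose complement has probability at most exp (- c k), and by b on
    that complement; integrating gives the first claim [expectation_le_whp].

    For the hitting time K of the tolerance eps, E[K] is the sum over k of
    P[K > k] [integral_hitting_time]. The terms with k < Ct eps^-2 are bounded
    by 1. For the others the hypothesis is used at a tolerance that depends on
    k: eps' := sqrt (Ct / k) satisfies eps' <= eps and Ct eps'^-2 = k. A smaller
    tolerance is hit later, so P[K > k] is at most the probability that eps' is
    hit after time k, that is at most exp (- ct eps'^-2) = exp (- ct / Ct) ^ k.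
    The geometric tail sums to a constant free of eps, whence the second claim
    with Ct1 = Ct and 1 / ct1 = 1 + 1 / (1 - exp (- ct / Ct)). *)

(** * Measurability of the gradient norms *)

Lemma enorm_ge0 (R : realType) (n : nat) (v : 'cV[R]_n) : 0 <= enorm v.
Proof. exact: sqrtr_ge0. Qed.

Lemma enorm_continuous (R : realType) (n : nat) :
  continuous (@enorm R n : 'cV[R]_n -> R).
Proof.
move=> v; apply: continuous_comp; last exact: sqrt_continuous.
have Fv : Filter (nbhs v) by exact: nbhs_filter.
apply: (cvg_big (op := +%R)) => [|i _]; first exact: add_continuous.
by apply: continuousM; exact: coord_continuous.
Qed.

Lemma measurable_continuous_comp (d : measure_display) (T : measurableType d)
    (R : realType) (m n : nat) (X : T -> 'M[R]_(m, n))
    (phi : 'M[R]_(m, n) -> R) :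
  borel_measurable X -> continuous phi -> measurable_fun [set: T] (phi \o X).
Proof.
move=> mX /continuousP phic.
apply: (measurability _ (RGenOpens.measurableE R)) => _ [_ [a [b ->]] <-].
rewrite comp_preimage; apply: mX => //; apply: sub_sigma_algebra.
exact/phic/interval_open.
Qed.

Lemma measurable_fun_bigmin (d : measure_display) (T : measurableType d)
    (R : realType) (I : Type) (r : seq I) (g0 : T -> R) (g : I -> T -> R) :
  measurable_fun [set: T] g0 -> (forall i, measurable_fun [set: T] (g i)) ->
  measurable_fun [set: T] (fun w => \big[Order.min/g0 w]_(i <- r) g i w).
Proof.
move=> mg0 mg; elim: r => [|i r IHr].
  by under eq_fun do rewrite big_nil.
by under eq_fun do rewrite big_cons; exact: measurable_minr.
Qed.

(** * Expectation of a bounded variable that is small with high probability *)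

(** Pointwise X <= a + b * 1_{X > a}, and the event X > a has probability at
    most q. *)
Lemma expectation_le_whp (d : measure_display) (T : measurableType d)
    (R : realType) (P : probability T R) (X : T -> R) (a b q : R) :
  measurable_fun [set: T] X -> (forall w, 0 <= X w <= b) -> 0 <= a -> 0 <= b ->
  ((1 - q)%:E <= P [set w | (X w <= a)%R])%E ->
  ('E_P[X] <= (a + b * q)%:E)%E.
Proof.
move=> mX Xb a0 b0 whp; set A := [set w | X w <= a] in whp.
have mA : measurable A.
  by rewrite -[A]setTI; exact: measurable_fun_le.
have mAC : measurable (~` A) by exact: measurableC.
have PAC : (P (~` A) <= q%:E)%E.
  rewrite probability_setC// leeBlDr ?fin_num_measure//.
  by rewrite -leeBlDl// -EFinB.
have mI : measurable_fun [set: T] (fun w => (\1_(~` A) w)%:E : \bar R).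
  exact/measurable_EFinP/measurable_indic.
rewrite unlock.
apply: (@le_trans _ _ (\int[P]_w (a%:E + b%:E * (\1_(~` A) w)%:E))%E).
  apply: ge0_le_integral => //.
  - by move=> w _ /=; rewrite lee_fin; case/andP: (Xb w).
  - exact/measurable_EFinP.
  - by apply: emeasurable_funD => //; exact: measurable_funeM.
  - move=> w _ /=; rewrite -EFinM -EFinD lee_fin indicE.
    case: (pselect (A w)) => Aw.
      by rewrite memNset ?mulr0 ?addr0//; apply.
    by rewrite mem_set// mulr1 -[X w]add0r lerD//; case/andP: (Xb w).
rewrite ge0_integralD//; last 2 first.
- by move=> w _; rewrite -EFinM lee_fin mulr_ge0.
- exact: measurable_funeM.
rewrite ge0_integralZl_EFin// integral_cst//.
rewrite [X in (_ * X + _)%E](probability_setT P) mule1.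
rewrite integral_indic// setIT EFinD EFinM.
by apply: leeD => //; apply: lee_wpmul2l => //; rewrite lee_fin.
Qed.

(** * Hitting times *)

Definition hitting_time {R : realType} (u : nat -> R) (eps : R) : \bar R :=
  ereal_inf [set (k%:R)%:E | k in [set k : nat | u k <= eps]].

Section hitting_time.
Context {d : measure_display} {T : measurableType d} {R : realType}.
Variables (u : nat -> T -> R) (eps : R).

Definition unhit (k : nat) : set T :=
  [set w | forall j, (j <= k)%N -> eps < u j w].

Lemma measurable_unhit k : (forall j, measurable_fun [set: T] (u j)) ->
  measurable (unhit k).
Proof.
move=> mu.
rewrite (_ : unhit k = \bigcap_(j in `I_k.+1) [set w | eps < u j w]).
  apply: bigcap_measurableType => j _.
  rewrite (_ : [set w | _] = ~` [set w | u j w <= eps]).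
    apply: measurableC; rewrite -[X in measurable X]setTI.
    exact: measurable_fun_le.
  by apply/seteqP; split => w /=; rewrite ltNge => /negP.
by apply/seteqP; split => w wk j /=; [rewrite ltnS|move=> jk]; exact: wk.
Qed.

Lemma hitting_time_le_nat k :
  [set w | (hitting_time (u ^~ w) eps <= k%:R%:E)%E] = ~` unhit k.
Proof.
apply/seteqP; split => w /=.
  (* Not being hit up to time k pushes the infimum to k.+1, past k. *)
  move=> wk uk; have : (k.+1%:R%:E <= hitting_time (u ^~ w) eps)%E.
    apply: le_ereal_inf_tmp => _ [j /= uj <-]; rewrite lee_fin ler_nat ltnNge.
    by apply/negP => /uk; rewrite ltNge uj.
  by move=> /le_trans/(_ wk); rewrite lee_fin ler_nat ltnn.
move=> /existsNP[j /not_implyP[jk /negP]]; rewrite -leNgt => uj.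
apply: (@le_trans _ _ (j%:R%:E)); last by rewrite lee_fin ler_nat.
by apply: ereal_inf_lbound; exists j.
Qed.

(** A natural number, or infinity, is the number of naturals k below it; this is
    what makes the expectation a sum of tail probabilities, and it exhibits the
    hitting time as a measurable function. *)
Lemma hitting_timeE w :
  hitting_time (u ^~ w) eps = (\sum_(0 <= k <oo) (\1_(unhit k) w)%:E)%E.
Proof.
have nn k : (0 <= (\1_(unhit k) w)%:E :> \bar R)%E by rewrite lee_fin.
have partial m : unhit m w ->
    (\sum_(0 <= k < m.+1) (\1_(unhit k) w)%:E = m.+1%:R%:E :> \bar R)%E.
  move=> um; rewrite sumEFin big_nat (eq_bigr (fun=> 1)).
    by rewrite -big_nat big_const_nat subn0 iter_addr addr0.
  move=> k; rewrite /= ltnS => km; rewrite indicE mem_set// => j jk.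
  exact/um/(leq_trans jk).
have [[m um]|never] := pselect (exists m, u m w <= eps).
  have := ex_minnP (ex_intro (fun m => u m w <= eps) m um).
  move=> [{um}m um umin].
  have -> : hitting_time (u ^~ w) eps = m%:R%:E.
    apply/eqP; rewrite eq_le; apply/andP; split.
      by apply: ereal_inf_lbound; exists m.
    by apply: le_ereal_inf_tmp => _ [j /= uj <-]; rewrite lee_fin ler_nat umin.
  rewrite (nneseries_split 0 m)// add0n.
  rewrite [X in (_ + X)%E]eseries0 ?adde0; last first.
    move=> k mk _; rewrite indicE memNset// => /(_ m mk).
    by rewrite ltNge um.
  case: m um umin => [|m] um umin; first by rewrite big_geq.
  rewrite partial// => j jm; rewrite ltNge; apply/negP => /umin.
  by rewrite leqNgt ltnS jm.
have late k : unhit k w.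
  by move=> j _; rewrite ltNge; apply/negP => uj; apply: never; exists j.
have -> : hitting_time (u ^~ w) eps = +oo%E.
  rewrite /hitting_time (_ : [set k | _] = set0) ?image_set0 ?ereal_inf0//.
  by rewrite -subset0 => k uk; apply: never; exists k.
apply/esym/eqyP => x x0.
apply: (@le_trans _ _
    (\sum_(0 <= k < (Num.truncn x).+1) (\1_(unhit k) w)%:E)%E).
  by rewrite partial// lee_fin ltW// truncnS_gt.
exact: nneseries_lim_ge.
Qed.

Lemma integral_hitting_time (P : probability T R) :
  (forall j, measurable_fun [set: T] (u j)) ->
  (\int[P]_w hitting_time (u ^~ w) eps = \sum_(0 <= k <oo) P (unhit k))%E.
Proof.
move=> mu; under eq_integral do rewrite hitting_timeE.
rewrite integral_nneseries//.
- apply: eq_eseriesr => k _; rewrite integral_indic ?setIT//.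
  exact: measurable_unhit.
- by move=> k; apply/measurable_EFinP/measurable_indic/measurable_unhit.
Qed.

End hitting_time.

(** The number of indices below M is at most M + 1, which bounds the head of the
    series. *)
Lemma nneseries_le_geometric_tail (R : realType) (p : nat -> \bar R) (M q : R) :
  0 <= M -> 0 < q < 1 -> (forall k, 0 <= p k <= 1)%E ->
  (forall k, M <= k%:R -> (p k <= (q ^+ k)%:E)%E) ->
  (\sum_(0 <= k <oo) p k <= (M + 1 + (1 - q)^-1)%:E)%E.
Proof.
move=> M0 /andP[q0 q1] p01 ptail.
apply: lime_le.
  by apply: is_cvg_nneseries => k _ _; case/andP: (p01 k).
apply: nearW => n.
have q1' : 0 < 1 - q by rewrite subr_gt0.
pose N := (Num.truncn M).+1.
apply: (@le_trans _ _ (\sum_(0 <= k < n) ((k < N)%N%:R + q ^+ k)%:E)%E).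
  apply: lee_sum => k _; have [kN|Nk] := ltnP k N.
    apply: (@le_trans _ _ 1%E); first by case/andP: (p01 k).
    by rewrite lee_fin lerDl exprn_ge0// ltW.
  rewrite add0r; apply: ptail; apply: ltW.
  by apply: (lt_le_trans (truncnS_gt M)); rewrite ler_nat.
rewrite sumEFin lee_fin big_split/= lerD//.
  rewrite -natr_sum.
  apply: (@le_trans _ _ N%:R); last first.
    by rewrite /N -addn1 natrD lerD2r; case/andP: (truncn_itv M0).
  rewrite ler_nat (_ : (\sum_(0 <= k < n) (k < N))%N = minn n N) ?geq_minr//.
  elim: n => [|n IHn]; first by rewrite big_geq// min0n.
  rewrite big_nat_recr//= IHn; lia.
rewrite big_mkord -(ler_pM2r q1') mulVf ?gt_eqF// mulrC -opprB mulNr -subrX1.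
by rewrite opprB gerBl exprn_ge0// ltW.
Qed.

(** The time k is reached by varying the tolerance: the tail bound at k comes
    from the hypothesis at sqrt (Ct / k), not at eps, whose own bound controls
    the distribution of its hitting time at the single time Ct eps^-2. *)
Lemma integral_hitting_time_le_whp (d : measure_display) (T : measurableType d)
    (R : realType) (P : probability T R) (u : nat -> T -> R) (eps0 ct Ct : R) :
  (forall j, measurable_fun [set: T] (u j)) -> 0 < ct -> 0 < Ct ->
  (forall eps : R, 0 < eps < eps0 ->
     ((1 - expR (- (ct * eps ^- 2)))%:E <=
      P [set w | hitting_time (u ^~ w) eps <= (Ct * eps ^- 2)%:E])%E) ->
  forall eps : R, 0 < eps < eps0 ->
    (\int[P]_w hitting_time (u ^~ w) eps <=
     (Ct * eps ^- 2 + 1 + (1 - expR (- (ct / Ct)))^-1)%:E)%E.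
Proof.
move=> mu ct0 Ct0 whp eps /andP[eps_gt0 eps_lt].
rewrite integral_hitting_time//.
have M0 : 0 < Ct * eps ^- 2 by rewrite mulr_gt0// invr_gt0 exprn_gt0.
apply: nneseries_le_geometric_tail => [|||k Mk].
- exact: ltW.
- by rewrite expR_gt0 expR_lt1 oppr_lt0 divr_gt0.
- by move=> k; rewrite measure_ge0 probability_le1//; exact: measurable_unhit.
have k0 : 0 < k%:R :> R by exact: lt_le_trans Mk.
(* The tolerance at which the assumed time bound is exactly k. *)
pose e := Num.sqrt (Ct / k%:R).
have e2 : e ^- 2 = k%:R / Ct by rewrite sqr_sqrtr ?invf_div// divr_ge0// ltW.
have e_gt0 : 0 < e by rewrite sqrtr_gt0 divr_gt0.
have e_le : e <= eps.
  rewrite -(@ler_pXn2r _ 2)// ?nnegrE ?(ltW e_gt0) ?(ltW eps_gt0)//.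
  rewrite sqr_sqrtr ?divr_ge0 ?(ltW Ct0)//.
  by rewrite ler_pdivrMr// [leRHS]mulrC -ler_pdivrMr ?exprn_gt0.
have e_itv : 0 < e < eps0 by rewrite e_gt0 (le_lt_trans e_le).
have := whp _ e_itv; rewrite e2 (mulrC Ct) divfK ?gt_eqF// hitting_time_le_nat.
have mU (x : R) : measurable (unhit u x k) by exact: measurable_unhit.
rewrite probability_setC// => whpk.
apply: (@le_trans _ _ (P (unhit u e k))).
  apply: le_measure; rewrite ?inE// => w uw j jk.
  exact: (le_lt_trans e_le (uw j jk)).
rewrite -expRM_natr mulNr mulrAC -mulrA.
move: whpk; rewrite -(@fineK _ (P (unhit u e k))) ?fin_num_measure//.
by rewrite -EFinB !lee_fin lerD2l lerN2.
Qed.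

(** * Expected complexity of the algorithm *)

Theorem theorem2p21 (R : realType) (d : measure_display) (T : measurableType d)
  (P : probability T R)
  (n p : nat) (f : 'cV[R]_n -> R) (x0 : 'cV[R]_n)
  (prm : rsdfo_params R) (kef keg : R) (S : T -> trajectory R n p)
  (f_low L kappaH c1 alphaQ deltaS Qmax : R)
  (k0 : nat) (c C : R) (eps0 ct Ct : R)
  (* RSDFO *)
  (p_bounds : (1 <= p <= n)%N)
  (prm_ok : valid_params prm)
  (S_random : random_trajectory S)
  (S_rsdfo : forall w, rsdfo_execution prm kef keg f x0 (S w))
  (* (i) *)
  (f_bounded : forall x, f_low <= f x)
  (f_C1 : continuously_differentiable f)
  (L_gt0 : 0 < L)
  (grad_f_lip : grad_lipschitz_on f L
     [set y | exists x, f x <= f x0 /\ enorm (y - x) <= Delta_max prm])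
  (* (ii) *)
  (kappaH_ge1 : 1 <= kappaH)
  (H_bounded : forall w k, opnorm (Hh (S w) k) <= kappaH)
  (* (iii) *)
  (c1_bounds : 2^-1 <= c1 <= 1)
  (S_decrease : forall w, solver_decrease prm kef keg c1 f (S w))
  (* (iv) *)
  (alphaQ_bounds : 0 < alphaQ < 1)
  (deltaS_bounds : 0 < deltaS < 1)
  (S_aligned : well_aligned_whp P f alphaQ deltaS S)
  (Qmax_gt0 : 0 < Qmax)
  (Q_bounded : forall w k, opnorm (Qk (S w) k) <= Qmax)
  (* (v) *)
  (beta_F_le : beta_F prm <= 2 * c1 / (1 + Num.sqrt (1 + 2 * c1)))
  (gamma_inc_gt : (gamma_min prm) ^- 2 < gamma_inc prm)
  (deltaS_lt : deltaS < 1 / (1 + C4 prm))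
  (* high-probability bounds *)
  (c_gt0 : 0 < c) (C_gt0 : 0 < C)
  (whp_grad : forall k : nat, (k0 <= k)%N ->
     ((1 - expR (- (c * k%:R)))%:E <=
      P [set w | (min_grad f (S w) k <= C / Num.sqrt k%:R)%R])%E)
  (eps0_gt0 : 0 < eps0) (ct_gt0 : 0 < ct) (Ct_gt0 : 0 < Ct)
  (whp_K : forall eps : R, 0 < eps < eps0 ->
     ((1 - expR (- (ct * eps ^- 2)))%:E <=
      P [set w | K_eps f (S w) eps <= (Ct * eps ^- 2)%:E])%E) :
  (forall k : nat, (k0 <= k)%N ->
     ('E_P [fun w => min_grad f (S w) k] <=
      (C / Num.sqrt k%:R + enorm (grad f x0) * expR (- (c * k%:R)))%:E)%E) /\
  (exists ct1 Ct1 : R, [/\ 0 < ct1, 0 < Ct1 &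
     forall eps : R, 0 < eps < eps0 ->
       (\int[P]_w K_eps f (S w) eps <= (Ct1 * eps ^- 2 + 1 / ct1)%:E)%E]).
Proof.
have mgrad k : measurable_fun [set: T] (fun w => enorm (grad f (xk (S w) k))).
  have gradc : continuous (@enorm R n \o grad f : 'cV[R]_n -> R).
    move=> x; apply: continuous_comp; first exact: f_C1.2.
    exact: enorm_continuous.
  exact: (measurable_continuous_comp _ _ _ _ _ _ _
            (xk_measurable S_random k) gradc).
have x00 w : xk (S w) 0 = x0 by case: (S_rsdfo w).
split=> [k k0k|].
  apply: expectation_le_whp; last exact: whp_grad.
  - exact: measurable_fun_bigmin.
  - move=> w; rewrite /min_grad -(x00 w) bigmin_le_id andbT.
    by apply: le_bigmin => [|j _]; exact: enorm_ge0.
  - by rewrite divr_ge0 ?sqrtr_ge0 ?(ltW C_gt0).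
  - exact: enorm_ge0.
pose q := expR (- (ct / Ct)).
have q1 : 0 < 1 - q by rewrite subr_gt0 expR_lt1 oppr_lt0 divr_gt0.
exists (1 + (1 - q)^-1)^-1, Ct; split => //.
  by rewrite invr_gt0 addr_gt0// invr_gt0.
move=> eps eps_itv; rewrite div1r invrK addrA.
exact: (integral_hitting_time_le_whp _ _ _ _ _ _ _ _ mgrad ct_gt0 Ct_gt0
          whp_K).
Qed.
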